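(* Let $y=y^\dagger+\varepsilon\in\mathbb R^m$ with $y^\dagger\in\operatorname{ran}(A)$ and $\varepsilon\in\mathbb R^m$, and let $\{u^j\}_{j=1}^J$ solve the naive EKI dynamics $$\dot u^j(t)=-C(t)A^T\Gamma^{-1}(Au^j(t)-y),\qquad u^j(0)=u^j_0,\qquad j=1,\dots,J,\ t\ge0,$$ where $m(t)=\frac1J\sum_{j=1}^Ju^j(t)$ and $C(t)=\frac1J\sum_{j=1}^J(u^j(t)-m(t))(u^j(t)-m(t))^T$ are the sample mean and sample covariance, $m_0=m(0)$, $C_0=C(0)$. Let $u\in\mathbb R^n$ be an arbitrary element satisfying $Au=y^\dagger$. Then for all $t\ge0$ and all $j$ $$u^j(t)=u^j_0+\left(E-\sqrt{C(t)C_0^{-1}}\right)(u-u^j_0)+\sqrt{C(t)C_0^{-1}}\int_0^t\sqrt{C(s)C_0^{-1}}\,ds\;C_0A^T\Gamma^{-1}\varepsilon,$$ $$m(t)=m_0+\left(E-\sqrt{C(t)C_0^{-1}}\right)(u-m_0)+\sqrt{C(t)C_0^{-1}}\int_0^t\sqrt{C(s)C_0^{-1}}\,ds\;C_0A^T\Gamma^{-1}\varepsilon,$$ and $$\lim_{t\to\infty}u^j(t)=u^{j,\dagger}+(A^T\Gamma^{-1}A)^-(A^T\Gamma^{-1}\varepsilon),\qquad \lim_{t\to\infty}m(t)=m^\dagger+(A^T\Gamma^{-1}A)^-(A^T\Gamma^{-1}\varepsilon),$$ where, with $C_\infty=\lim_{t\to\infty}C(t)$, $u^{j,\dagger}=u^j_0+(E-C_\infty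 C_0^{-1})(u-u^j_0)$ and $m^\dagger=m_0+(E-C_\infty C_0^{-1})(u-m_0)$ are equivalently characterized by $$u^{j,\dagger}=\operatorname{arg\,min}\{\|v-u^j_0\|_{C_0}: v\in\mathbb R^n,\ Av=y^\dagger\},\qquad m^\dagger=\operatorname{arg\,min}\{\|v-m_0\|_{C_0}: v\in\mathbb R^n,\ Av=y^\dagger\}.$$ Alternatively, $$\lim_{t\to\infty}u^j(t)=\operatorname{arg\,min}\{\|v-u^j_0\|_{C_0}: v\in\mathbb R^n,\ Av=\Pi^\Gamma_{\operatorname{ran}(A)}(y)\},$$ $$\lim_{t\to\infty}m(t)=\operatorname{arg\,min}\{\|v-m_0\|_{C_0}: v\in\mathbb R^n,\ Av=\Pi^\Gamma_{\operatorname{ran}(A)}(y)\}.$$ The rate of convergence is $1/\sqrt t$: the distances of $u^j(t)$ and of $m(t)$ to their respective limits are $O(1/\sqrt t)$ as $t\to\infty$.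
   Context: $A\in\mathbb R^{m\times n}$; $\Gamma\in\mathbb R^{m\times m}$ is symmetric positive definite; the initial sample covariance $C_0\in\mathbb R^{n\times n}$ is assumed symmetric positive definite (invertible); $E$ is the $n\times n$ identity. For a symmetric positive definite $H$, $\langle x,z\rangle_H:=\langle x,H^{-1}z\rangle$ and $\|x\|_H^2:=\langle x,H^{-1}x\rangle$. $\Pi_V^\Gamma$ is the orthogonal projection onto a subspace $V\subset\mathbb R^m$ with respect to $\langle\cdot,\cdot\rangle_\Gamma$. The matrix $C_0A^T\Gamma^{-1}A$ is diagonalizable, $C_0A^T\Gamma^{-1}A=SDS^{-1}$ with $D=\operatorname{diag}(\mu_1,\dots,\mu_k,0,\dots,0)$, $\mu_1\ge\dots\ge\mu_k>0$ (and $\mu_i=0$ for $i>k$). One has $C(t)C_0^{-1}=S\operatorname{diag}\left(\frac1{1+2t\mu_i}\right)_{i=1}^nS^{-1}$, and $\sqrt{C(t)C_0^{-1}}$ denotes $S\operatorname{diag}\left((1+2t\mu_i)^{-1/2}\right)_{i=1}^nS^{-1}$. For a diagonalizable matrix $M=U\Lambda U^{-1}$ with $\Lambda=\operatorname{diag}(a_1,\dots,a_k,0,\dots,0)$, $a_i\ne0$, define $M^+=U\operatorname{diag}(a_1^{-1},\dots,a_k^{-1},0,\dots,0)U^{-1}$. Then $(A^T\Gamma^{-1}A)^-:=(C_0A^T\Gamma^{-1}A)^+C_0=SD^+S^{-1}C_0$ (not the Moore–Penrose inverse in general). *)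

(* Defs.v *)
From mathcomp Require Export all_boot all_order all_algebra.
From mathcomp Require Export all_classical all_reals all_analysis.
Export Order.TTheory GRing.Theory Num.Theory.
Export numFieldNormedType.Exports.

#[export] Set Implicit Arguments.
#[export] Unset Strict Implicit.
#[export] Unset Printing Implicit Defensive.

Local Open Scope classical_set_scope.
Local Open Scope ring_scope.

Section LinearAlgebra.
Variable R : realType.

Definition sym_posdef (p : nat) (H : 'M[R]_p) : Prop :=
  H^T = H /\ forall x : 'cV[R]_p, x != 0 -> 0 < (x^T *m H *m x) 0 0.

(* The inner product and the norm are weighted by the inverse of H. *)
Definition dotH (p : nat) (H : 'M[R]_p) (x z : 'cV[R]_p) : R :=
  (x^T *m invmx H *m z) 0 0.

Definition normH (p : nat) (H : 'M[R]_p) (x : 'cV[R]_p) : R :=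
  Num.sqrt (dotH H x x).

(* When H is positive definite and V is a subspace, exactly one p qualifies;
   the default value 0 is then irrelevant. *)
Definition orth_proj (p : nat) (H : 'M[R]_p) (V : set 'cV[R]_p)
    (z : 'cV[R]_p) : 'cV[R]_p :=
  xget 0 [set q | V q /\ forall v, V v -> dotH H v (z - q) = 0].

(* The set of all minimizers of F over D; "v = arg min" is rendered as
   argmin F D = [set v], so that uniqueness is part of the claim. *)
Definition argmin (T : Type) (F : T -> R) (D : set T) : set T :=
  [set v | D v /\ forall w, D w -> F v <= F w].

(* Indices are shifted by one: the positive eigenvalues are mu 0 i, i < k. *)
Definition diagonalized_by (n : nat) (M S : 'M[R]_n) (mu : 'rV[R]_n)
    (k : nat) : Prop :=
  [/\ S \in unitmx,
      M = S *m diag_mx mu *m invmx S,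
      (k <= n)%N,
      (forall i j : 'I_n, (i <= j)%N -> mu 0 j <= mu 0 i) &
      forall i : 'I_n,
        ((i < k)%N -> 0 < mu 0 i) /\ ((k <= i)%N -> mu 0 i = 0)].

Definition diag_conj (n : nat) (S : 'M[R]_n) (a : 'rV[R]_n) : 'M[R]_n :=
  S *m diag_mx a *m invmx S.

(* M^+ for M = diag_conj S a; only the nonzero a_i get inverted, because
   0^-1 = 0 in a field. *)
Definition diag_pinv (n : nat) (S : 'M[R]_n) (a : 'rV[R]_n) : 'M[R]_n :=
  diag_conj S (\row_i (a 0 i)^-1).

End LinearAlgebra.

Section Calculus.
Variable R : realType.

(* Derivative at t of a function on [0, +oo[ : the increments h are restricted
   to 0 <= t + h, so the derivative is one-sided at t = 0 and nothing is
   required of f on negative arguments. *)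
Definition has_deriv_ge0 (n : nat) (f : R -> 'cV[R]_n) (t : R)
    (d : 'cV[R]_n) : Prop :=
  h^-1 *: (f (t + h) - f t) @[h --> within [set h | 0 <= t + h] 0^'] --> d.

Definition mx_integral (p q : nat) (a b : R) (F : R -> 'M[R]_(p, q)) :
    'M[R]_(p, q) :=
  \matrix_(i, j) (\int[lebesgue_measure]_(s in `[a, b]) F s i j)%R.

End Calculus.

Section EKI.
Variables (R : realType) (m n J : nat).
Implicit Types u : 'I_J -> R -> 'cV[R]_n.

Definition sample_mean u (t : R) : 'cV[R]_n := J%:R^-1 *: \sum_j u j t.

Definition sample_cov u (t : R) : 'M[R]_n :=
  J%:R^-1 *: \sum_j (u j t - sample_mean u t) *m (u j t - sample_mean u t)^T.

Definition naive_EKI (A : 'M[R]_(m, n)) (Gamma : 'M[R]_m) (y : 'cV[R]_m)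
    (u0 : 'I_J -> 'cV[R]_n) u : Prop :=
  (forall j, u j 0 = u0 j) /\
  forall j t, 0 <= t ->
    has_deriv_ge0 (u j) t
      (- (sample_cov u t *m A^T *m invmx Gamma *m (A *m u j t - y))).

(* The square root of C(t) C0^-1, from an eigendecomposition
   C0 A^T Gamma^-1 A = S diag(mu) S^-1. *)
Definition sqrtCC0 (S : 'M[R]_n) (mu : 'rV[R]_n) (t : R) : 'M[R]_n :=
  diag_conj S (\row_i (Num.sqrt (1 + 2 * t * mu 0 i))^-1).

End EKI.

(* Main.v *)
(** The deviations u^j - m satisfy a linear equation driven by -C B, with
B = A^T Gamma^-1 A, so C solves the Riccati equation C' = -2 C B C and
C(t)^-1 = C_0^-1 + 2 t B.  Hence C(t) C_0^-1 = (E + 2 t M)^-1 for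
M = C_0 B = S diag(mu) S^-1, and in the eigencoordinates w = S^-1 (u^j - x) the
particle equation decouples into w_i' = (e_i - mu_i w_i) / (1 + 2 t mu_i), with
e = S^-1 C_0 A^T Gamma^-1 eps, which has the integrating factor
sqrt(1 + 2 t mu_i).  The coordinates with mu_i = 0 are constant because e_i = 0
there; the other ones differ from e_i / mu_i by a multiple of
(1 + 2 t mu_i)^(-1/2).  The limits are minimizers because they are feasible and
differ from the initial value by an element of ran (C_0 A^T), the orthogonal
complement of ker A for the inner product weighted by C_0^-1. *)

Require Import Defs.
From mathcomp Require Import ring lra perm complex.

Local Open Scope classical_set_scope.
Local Open Scope ring_scope.

(** * Calculus on the half-line *)

Section RayCalculus.
Variable R : realType.
Implicit Types f g : R -> R.

(** At 0 only right-continuity is asked and [f' 0] is unconstrained; this is enough for the mean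
    value theorem on [[0, t]]. *)
Definition deriv_ray f f' : Prop :=
  (forall t : R, 0 < t -> is_derive t 1 f (f' t)) /\ f s @[s --> 0^'+] --> f 0.

Lemma deriv_ray_cst (c : R) : deriv_ray (fun=> c) (fun=> 0).
Proof. by split=> [t _|]; [exact: is_derive_cst|exact: cvg_cst]. Qed.

Lemma deriv_ray_id : deriv_ray (fun s : R => s) (fun=> 1).
Proof.
split=> [s _|]; first exact: is_derive_id.
exact: (cvg_at_right_filter (@cvg_id _ _)).
Qed.

Lemma deriv_rayD f f' g g' : deriv_ray f f' -> deriv_ray g g' ->
  deriv_ray (fun t => f t + g t) (fun t => f' t + g' t).
Proof.
move=> [df cf] [dg cg]; split=> [t t0|]; last exact: cvgD.
exact: (is_deriveD (df t t0) (dg t t0)).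
Qed.

Lemma deriv_rayM f f' g g' : deriv_ray f f' -> deriv_ray g g' ->
  deriv_ray (fun t => f t * g t) (fun t => f' t * g t + f t * g' t).
Proof.
move=> [df cf] [dg cg]; split=> [t t0|]; last exact: cvgM.
apply: (is_derive_eq (is_deriveM (df t t0) (dg t t0))).
by rewrite addrC /GRing.scale /= [g t * _]mulrC.
Qed.

Lemma deriv_rayV (f f' : R -> R) : deriv_ray f f' ->
  (forall t : R, 0 <= t -> f t != 0) ->
  deriv_ray (fun t => (f t)^-1) (fun t => - (f t) ^- 2 * f' t).
Proof.
move=> [df cf] f0; split=> [t t0|]; last exact: cvgV (f0 0 (lexx 0)) cf.
by apply: is_deriveV; [exact: f0 (ltW t0)|exact: df].
Qed.

Lemma deriv_ray_sqrt (f f' : R -> R) : deriv_ray f f' ->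
  (forall t : R, 0 <= t -> 0 < f t) ->
  deriv_ray (fun t => Num.sqrt (f t)) (fun t => (2 * Num.sqrt (f t))^-1 * f' t).
Proof.
move=> [df cf] f0; split=> [t t0|].
  have ds := is_derive1_sqrt (f0 t (ltW t0)).
  exact: (is_derive1_comp ds (df t t0)).
exact: (cvg_comp _ _ cf (@sqrt_continuous _ _)).
Qed.

Lemma deriv_ray_sum (I : Type) (r : seq I) (P : pred I) (f f' : I -> R -> R) :
  (forall i, deriv_ray (f i) (f' i)) ->
  deriv_ray (fun t => \sum_(i <- r | P i) f i t)
            (fun t => \sum_(i <- r | P i) f' i t).
Proof.
move=> df; elim: r => [|i r IH].
  under eq_fun do rewrite big_nil.
  under [X in deriv_ray _ X]eq_fun do rewrite big_nil.
  exact: deriv_ray_cst.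
under eq_fun do rewrite big_cons.
under [X in deriv_ray _ X]eq_fun do rewrite big_cons.
by case: (P i) => //; exact: deriv_rayD.
Qed.

Lemma deriv_ray_LRcontinuous f f' t : deriv_ray f f' -> 0 < t ->
  derivable_oo_LRcontinuous f 0 t.
Proof.
move=> [df cf] t0; split=> // [s|].
  by rewrite in_itv/= => /andP[s0 _]; have [] := df s s0.
apply: cvg_at_left_filter; apply: differentiable_continuous.
by apply/derivable1_diffP; have [] := df t t0.
Qed.

Lemma deriv_ray_nincr f f' : deriv_ray f f' ->
  (forall t : R, 0 < t -> f' t <= 0) -> forall t : R, 0 <= t -> f t <= f 0.
Proof.
move=> df f'0 t; rewrite le_eqVlt => /predU1P[<-//|t0].
have [dft _ _] := deriv_ray_LRcontinuous df t0.
apply: (@ler0_derive1_le_cc _ f 0 t) => //; rewrite ?in_itv/= ?lexx ?(ltW t0)//.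
  move=> s; rewrite in_itv/= => /andP[s0 _].
  by rewrite derive1E; have [_ ->] := df.1 s s0; exact: f'0.
exact: derivable_oo_LRcontinuous_within (deriv_ray_LRcontinuous df t0).
Qed.

Lemma deriv_ray_eq0 f f' : deriv_ray f f' ->
  (forall t : R, 0 < t -> f' t = 0) -> forall t : R, 0 <= t -> f t = f 0.
Proof.
move=> df f'0 t t0; apply/le_anti/andP; split.
  by apply: (deriv_ray_nincr df) => // s /f'0->.
rewrite -lerN2 -[- f 0]mulN1r -[- f t]mulN1r.
apply: (deriv_ray_nincr (deriv_rayM (deriv_ray_cst (-1)) df)) => // s /f'0->.
by rewrite mul0r mulr0 addr0.
Qed.

(** Negative arguments do not matter: all points near some [t > 0] are positive, and the limit at 0
    is taken from the right. *)
Lemma deriv_ray_ext f f' g g' : (forall t : R, 0 <= t -> f t = g t) ->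
  (forall t : R, 0 < t -> f' t = g' t) -> deriv_ray f f' -> deriv_ray g g'.
Proof.
move=> fg fg' [df cf]; split=> [t t0|].
  rewrite -fg' //; apply: (near_eq_is_derive _ (df t t0)).
  by near=> s; apply: fg; apply: ltW; near: s; exact: lt_nbhsr.
rewrite -fg //; apply: cvg_trans cf; apply: near_eq_cvg.
near=> s; apply: fg; apply: ltW; near: s; exact: nbhs_right_gt.
Unshelve. all: by end_near. Qed.

Definition mderiv_ray (p q : nat) (F F' : R -> 'M[R]_(p, q)) : Prop :=
  forall i j, deriv_ray (fun t => F t i j) (fun t => F' t i j).

Lemma mderiv_ray_ext p q (F F' G G' : R -> 'M[R]_(p, q)) :
  (forall t : R, 0 <= t -> F t = G t) -> (forall t : R, 0 < t -> F' t = G' t) ->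
  mderiv_ray F F' -> mderiv_ray G G'.
Proof.
move=> FG FG' dF i j.
by apply: deriv_ray_ext (dF i j) => t t0; rewrite ?FG ?FG'.
Qed.

Lemma mderiv_ray_cst p q (A : 'M[R]_(p, q)) : mderiv_ray (fun=> A) (fun=> 0).
Proof.
by move=> i j; apply: deriv_ray_ext (deriv_ray_cst (A i j)) => // t;
  rewrite mxE.
Qed.

Lemma mderiv_rayD p q (F F' G G' : R -> 'M[R]_(p, q)) :
  mderiv_ray F F' -> mderiv_ray G G' ->
  mderiv_ray (fun t => F t + G t) (fun t => F' t + G' t).
Proof.
move=> dF dG i j.
by apply: deriv_ray_ext (deriv_rayD (dF i j) (dG i j)) => t _; rewrite mxE.
Qed.

Lemma mderiv_rayM p q r (F F' : R -> 'M[R]_(p, q)) (G G' : R -> 'M[R]_(q, r)) :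
  mderiv_ray F F' -> mderiv_ray G G' ->
  mderiv_ray (fun t => F t *m G t) (fun t => F' t *m G t + F t *m G' t).
Proof.
move=> dF dG i j; apply: deriv_ray_ext
  (deriv_ray_sum _ _ (fun k => deriv_rayM (dF i k) (dG k j))) => t _.
  by rewrite mxE.
by rewrite !mxE big_split.
Qed.

Lemma mderiv_ray_tr p q (F F' : R -> 'M[R]_(p, q)) :
  mderiv_ray F F' -> mderiv_ray (fun t => (F t)^T) (fun t => (F' t)^T).
Proof. by move=> dF i j; apply: deriv_ray_ext (dF j i) => t _; rewrite mxE. Qed.

Lemma mderiv_rayZ p q (f f' : R -> R) (F F' : R -> 'M[R]_(p, q)) :
  deriv_ray f f' -> mderiv_ray F F' ->
  mderiv_ray (fun t => f t *: F t) (fun t => f' t *: F t + f t *: F' t).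
Proof.
move=> df dF i j.
by apply: deriv_ray_ext (deriv_rayM df (dF i j)) => t _; rewrite !mxE.
Qed.

Lemma mderiv_ray_sum p q (I : finType) (F F' : I -> R -> 'M[R]_(p, q)) :
  (forall k, mderiv_ray (F k) (F' k)) ->
  mderiv_ray (fun t => \sum_k F k t) (fun t => \sum_k F' k t).
Proof.
move=> dF i j.
by apply: deriv_ray_ext (deriv_ray_sum (index_enum I) predT
  (fun k => dF k i j)) => t _; rewrite summxE.
Qed.

Lemma mderiv_ray_eq0 p q (F : R -> 'M[R]_(p, q)) F' : mderiv_ray F F' ->
  (forall t : R, 0 < t -> F' t = 0) -> forall t : R, 0 <= t -> F t = F 0.
Proof.
move=> dF F'0 t t0; apply/matrixP => i j.
by apply: (deriv_ray_eq0 (dF i j)) => // s s0; rewrite F'0 // mxE.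
Qed.

(** For [t > 0] the restriction [0 <= t + h] is void for small [h], so the derivative is two-sided.
    At [t = 0] the convergent difference quotient [q] yields right-continuity through
    [f h = f 0 + h q]. *)
Lemma has_deriv_ge0_ray n (f f' : R -> 'cV[R]_n) :
  (forall t : R, 0 <= t -> has_deriv_ge0 f t (f' t)) -> mderiv_ray f f'.
Proof.
move=> df i j; have dfij t : 0 <= t ->
    h^-1 * (f (t + h) i j - f t i j) @[h --> within [set h | 0 <= t + h] 0^']
      --> f' t i j.
  move=> /df dft.
  have := cvg_comp _ _ dft (@coord_continuous _ _ _ i j (f' t)).
  by apply: cvg_trans; apply: near_eq_cvg; apply: nearW => h /=; rewrite !mxE.
split=> [t t0|].
  have Nt0 : - t < 0 by rewrite oppr_lt0.
  have th0 : \forall h \near (0:R)^', 0 <= t + h.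
    apply: nbhs_dnbhs; apply: filterS (lt_nbhsr Nt0) => h Nth.
    by rewrite -lerBlDl sub0r ltW.
  have dft : h^-1 * (f (t + h) i j - f t i j) @[h --> 0^'] --> f' t i j.
    apply: cvg_trans (dfij t (ltW t0)); apply: cvg_app => A wA.
    have {wA}: \forall h \near (0:R)^', 0 <= t + h -> A h by exact: wA.
    by move: th0; apply: filterS2 => h h0; exact.
  have dft' : h^-1 *: (((fun s => f s i j) \o shift t) (h *: 1) - f t i j)
      @[h --> 0^'] --> f' t i j.
    apply: cvg_trans dft; apply: near_eq_cvg; apply: nearW => h /=.
    by rewrite /GRing.scale /= mulr1 [h + t]addrC.
  split; first exact: (cvgP _ dft').
  exact: (cvg_lim _ dft').
have d0 : h^-1 * (f h i j - f 0 i j) @[h --> 0^'+] --> f' 0 i j.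
  move=> A /(dfij 0 (lexx 0)) wA.
  have {wA} : \forall h \near (0:R), h != 0 -> 0 <= 0 + h ->
      A (h^-1 * (f (0 + h) i j - f 0 i j)) by exact: wA.
  apply: filterS => h + h0; rewrite add0r; apply; last exact: ltW.
  by rewrite gt_eqF.
have id0 : h @[h --> (0:R)^'+] --> (0:R).
  exact: (cvg_at_right_filter (@cvg_id _ _)).
have : f 0 i j + h * (h^-1 * (f h i j - f 0 i j)) @[h --> 0^'+] --> f 0 i j.
  rewrite -[X in _ --> X]addr0 -[X in _ --> _ + X](mul0r (f' 0 i j)).
  by apply: cvgD; [exact: cvg_cst|exact: cvgM].
apply: cvg_trans; apply: near_eq_cvg; near=> h.
have h0 : h != 0 by rewrite gt_eqF //; near: h; exact: nbhs_right_gt.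
by rewrite mulrA mulfV // mul1r addrC subrK.
Unshelve. all: by end_near. Qed.

End RayCalculus.

(** * Positive definite and self-adjoint matrices *)

Section PositiveDefinite.
Variables (R : realType) (n : nat) (H : 'M[R]_n).
Hypothesis H_spd : sym_posdef H.

Lemma posdef_qform_ge0 (x : 'cV[R]_n) : 0 <= (x^T *m H *m x) 0 0.
Proof.
have [->|/(H_spd.2 x)/ltW//] := eqVneq x 0.
by rewrite mulmx0 mxE.
Qed.

Lemma posdef_qform_eq0 (x : 'cV[R]_n) : (x^T *m H *m x) 0 0 = 0 -> x = 0.
Proof. by apply: contra_eq => /(H_spd.2 x); rewrite lt0r => /andP[]. Qed.

Lemma mulmx_col_entry p q (K : 'M[R]_p) (X : 'M[R]_(p, q)) i :
  (X^T *m K *m X) i i = ((col i X)^T *m K *m col i X) 0 0.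
Proof.
rewrite !mxE; apply: eq_bigr => k _; rewrite !mxE; congr (_ * _).
by apply: eq_bigr => l _; rewrite !mxE.
Qed.

(** The diagonal entries of [X^T H X] are the values of the quadratic form at the columns of [X]. *)
Lemma posdef_diag_eq0 q (X : 'M[R]_(n, q)) :
  (forall i, (X^T *m H *m X) i i = 0) -> X = 0.
Proof.
move=> XHX; apply/matrixP => i j; have := XHX j.
rewrite mulmx_col_entry => /posdef_qform_eq0/matrixP/(_ i 0).
by rewrite !mxE.
Qed.

Lemma posdef_mul_eq0 q (X : 'M[R]_(n, q)) : X^T *m H *m X = 0 -> X = 0.
Proof. by move=> XHX; apply: posdef_diag_eq0 => i; rewrite XHX mxE. Qed.

Lemma posdef_unitmx : H \in unitmx.
Proof.
rewrite -row_free_unit; apply: inj_row_free => v vH.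
apply: trmx_inj; rewrite trmx0; apply: posdef_qform_eq0.
by rewrite trmxK vH mul0mx mxE.
Qed.

Lemma posdef_inv : sym_posdef (invmx H).
Proof.
have [HT _] := H_spd; split=> [|x x0]; first by rewrite trmx_inv HT.
have -> : x^T *m invmx H *m x = (invmx H *m x)^T *m H *m (invmx H *m x).
  rewrite trmx_mul trmx_inv HT !mulmxA -[_ *m H *m _]mulmxA.
  by rewrite mulmxV ?posdef_unitmx // mulmx1.
apply: H_spd.2; apply: contra_neq x0 => Hx.
by rewrite -[x](mulKVmx posdef_unitmx) Hx mulmx0.
Qed.

End PositiveDefinite.

(** * Real diagonalization of matrices self-adjoint for a weighted inner product *)

Section SelfAdjoint.
Variable R : realType.

(** [M G = G M^T] says that [v |-> v M] is self-adjoint for the inner product [v G w^T] on rows; it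
    passes to polynomials in [M] because [M] commutes with them. *)
Lemma selfadjoint_horner_mx n (G M : 'M[R]_n.+1) (p : {poly R}) :
  M *m G = G *m M^T -> horner_mx M p *m G = G *m (horner_mx M p)^T.
Proof.
move=> MG; elim/poly_ind: p => [|p c IH];
  first by rewrite rmorph0 trmx0 mul0mx mulmx0.
rewrite rmorphD rmorphM /= horner_mx_X horner_mx_C -mulmxE linearD /=.
rewrite tr_scalar_mx mulmxDl mulmxDr -mulmxA MG scalar_mxC; congr (_ + _).
rewrite mulmxA IH -!mulmxA -trmx_mul; congr (_ *m trmx _).
by apply: comm_mx_horner.
Qed.

(* For N := M - r and W := N q(M), N (N q(M)) = 0 gives W^2 = 0; as W is
   self-adjoint, W G W^T = W^2 G = 0: r carries no Jordan block. *)
Lemma selfadjoint_horner_sqr n (G M : 'M[R]_n.+1) r (q : {poly R}) :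
  sym_posdef G -> M *m G = G *m M^T ->
  horner_mx M (('X - r%:P) * (('X - r%:P) * q)) = 0 ->
  horner_mx M (('X - r%:P) * q) = 0.
Proof.
move=> Gpd MG NW; set W := horner_mx M _.
have WG : W *m G = G *m W^T by exact: selfadjoint_horner_mx.
suff WT0 : W^T = 0 by rewrite -[W]trmxK WT0 trmx0.
apply: (posdef_mul_eq0 Gpd); rewrite trmxK -mulmxA -WG mulmxA.
suff -> : W *m W = 0 by rewrite mul0mx.
rewrite mulmxE /W -rmorphM /= [X in horner_mx M X = _](_ :
  _ = ('X - r%:P) * (('X - r%:P) * q) * q); last by ring.
by rewrite rmorphM /= NW mul0r.
Qed.

(** Repeated copies of a root are dropped one at a time; [q] absorbs the factors that are kept, so
    that the induction can run over [rs]. *)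
Lemma selfadjoint_horner_undup n (G M : 'M[R]_n.+1) (rs : seq R)
    (q : {poly R}) :
  sym_posdef G -> M *m G = G *m M^T ->
  horner_mx M ((\prod_(r <- rs) ('X - r%:P)) * q) = 0 ->
  horner_mx M ((\prod_(r <- undup rs) ('X - r%:P)) * q) = 0.
Proof.
move=> Gpd MG; elim: rs q => [|r rs IH] q //=; rewrite big_cons.
case: ifPn => [r_rs|_].
  rewrite (perm_big _ (perm_to_rem r_rs)) big_cons /= -!mulrA => h.
  apply: IH; rewrite (perm_big _ (perm_to_rem r_rs)) big_cons /= -mulrA.
  exact: (selfadjoint_horner_sqr Gpd MG).
by rewrite big_cons -!mulrA mulrCA => /IH; rewrite mulrCA.
Qed.

(** Split a complex left eigenvector as [p + i q]. The symmetry of [p M G q^T] in [p] and [q] gives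
    [Im z (p G p^T + q G q^T) = 0], and the bracket is positive unless the eigenvector vanishes. *)
Lemma selfadjoint_eigen_real n (G M : 'M[R]_n) (z : R[i]) :
  sym_posdef G -> M *m G = G *m M^T ->
  eigenvalue (map_mx (real_complex R) M) z -> z = real_complex R (complex.Re z).
Proof.
move=> Gpd MG /eigenvalueP[v vM v0].
pose p := map_mx (@complex.Re R) v; pose q := map_mx (@complex.Im R) v.
have rows (f : {additive R[i] -> R}) :
    (forall a (b : R), f (a * b%:C)%C = f a * b) ->
    map_mx f v *m M = map_mx f (z *: v).
  move=> fM; apply/matrixP => i j; rewrite -vM !mxE raddf_sum.
  by apply: eq_bigr => k _; rewrite !mxE fM.
have pM : p *m M = complex.Re z *: p - complex.Im z *: q.
  rewrite rows; last by case=> a a' b /=; rewrite !mulr0 subr0.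
  apply/matrixP => i j; rewrite !mxE.
  by case: z {vM rows} => a b; case: (v i j).
have qM : q *m M = complex.Re z *: q + complex.Im z *: p.
  rewrite rows; last by case=> a a' b /=; rewrite !mulr0 add0r.
  apply/matrixP => i j; rewrite !mxE.
  by case: z {vM rows pM} => a b; case: (v i j).
have GT := Gpd.1.
have symMG (a b : 'rV[R]_n) : (a *m M *m G *m b^T) 0 0
  = (b *m M *m G *m a^T) 0 0.
  have -> : a *m M *m G *m b^T = (b *m M *m G *m a^T)^T.
    by rewrite !trmx_mul trmxK GT mulmxA !mulmxA -[a *m G *m _]mulmxA -MG
      !mulmxA.
  by rewrite mxE.
have ge0 (a : 'rV[R]_n) : 0 <= (a *m G *m a^T) 0 0.
  by have := posdef_qform_ge0 Gpd a^T; rewrite trmxK.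
have eq0 (a : 'rV[R]_n) : (a *m G *m a^T) 0 0 = 0 -> a = 0.
  have := @posdef_qform_eq0 _ _ _ Gpd a^T; rewrite trmxK => h /h a0.
  by rewrite -[a]trmxK a0 trmx0.
have symG (a b : 'rV[R]_n) : (a *m G *m b^T) 0 0 = (b *m G *m a^T) 0 0.
  have -> : a *m G *m b^T = (b *m G *m a^T)^T.
    by rewrite !trmx_mul trmxK GT mulmxA.
  by rewrite [LHS]mxE.
have := symMG p q; rewrite pM qM !(mulmxDl, mulmxBl, mulNmx) -!scalemxAl.
have [z0 _|z0] := eqVneq (complex.Im z) 0; first by case: (z) z0 => a b /= ->.
have entD (X Y : 'M[R]_1) : (X + Y) 0 0 = X 0 0 + Y 0 0 by rewrite mxE.
have entN (X : 'M[R]_1) : (- X) 0 0 = - X 0 0 by rewrite mxE.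
have entZ a (X : 'M[R]_1) : (a *: X) 0 0 = a * X 0 0 by rewrite mxE.
rewrite !(entD, entN, entZ) (symG q p) => E.
have {}E : complex.Im z * ((p *m G *m p^T) 0 0 + (q *m G *m q^T) 0 0) = 0.
  by move: E; lra.
move/eqP: E; rewrite mulf_eq0 (negPf z0) /= paddr_eq0 ?ge0 //.
case/andP=> /eqP/eq0 p0 /eqP/eq0 q0; case/eqP: v0; apply/matrixP => i j.
have := congr1 (fun a : 'rV[R]_n => a i j) p0.
have := congr1 (fun a : 'rV[R]_n => a i j) q0.
by rewrite !mxE; case: (v i j) => a b /= -> ->.
Qed.

(** The minimal polynomial splits over the complex numbers, its roots are real, and self-adjointness
    removes multiplicities: [M] is killed by a product of distinct real linear factors. *)
Lemma selfadjoint_diagonalizable n (G M : 'M[R]_n) :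
  sym_posdef G -> M *m G = G *m M^T ->
  exists2 P : 'M[R]_n, P \in unitmx & exists d, P *m M = diag_mx d *m P.
Proof.
(* Evaluating polynomials at a matrix needs a positive dimension; dimension 0 is trivial. *)
case: n G M => [|n] G M Gpd MG.
  by exists 1%:M; [exact: unitmx1|exists 0; apply/matrixP => -[]].
suff /diagonalizableP[P Pu /similar_diagPex[d /(similarP Pu) PM]] :
    exists2 rs, uniq rs & mxminpoly M %| \prod_(r <- rs) ('X - r%:P).
  by exists P => //; exists d.
have [zs] := closed_field_poly_normal (mxminpoly (map_mx (real_complex R) M)).
rewrite (monicP (mxminpoly_monic _)) scale1r => zsE.
have zs_real z : z \in zs -> z = real_complex R (complex.Re z).
  move=> zzs; apply: (selfadjoint_eigen_real Gpd MG).
  by rewrite eigenvalue_root_min zsE root_prod_XsubC.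
pose rs := map (@complex.Re R) zs.
have rsE : mxminpoly M = \prod_(r <- rs) ('X - r%:P).
  apply: (@map_poly_inj _ _ (real_complex R)); rewrite -mxminpoly_map zsE.
  rewrite rmorph_prod big_map big_seq [RHS]big_seq; apply: eq_bigr => z zzs.
  by rewrite rmorphB /= map_polyX map_polyC /= -zs_real.
exists (undup rs); first exact: undup_uniq.
apply: mxminpoly_min; rewrite -[X in horner_mx _ X]mulr1.
by apply: (selfadjoint_horner_undup Gpd MG); rewrite mulr1 -rsE mx_root_minpoly.
Qed.

Lemma sorting_perm n (d : 'rV[R]_n) :
  exists s : {perm 'I_n},
    forall i j : 'I_n, (i <= j)%N -> d 0 (s j) <= d 0 (s i).
Proof.
pose le i j := d 0 j <= d 0 i; pose l := sort le (enum 'I_n).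
have szl : size l == n by rewrite size_sort size_enum_ord.
have inj : injective (tnth (Tuple szl)).
  by apply/tuple_uniqP; rewrite /= sort_uniq enum_uniq.
exists (perm inj) => i j ij; rewrite !permE !(tnth_nth i) /=.
have sl : sorted le l by apply: sort_sorted => a b; exact: le_total.
apply: (sorted_leq_nth _ _ i sl) => //; rewrite ?inE ?(eqP szl) //.
- by move=> a b c ba cb; exact: le_trans cb ba.
- by move=> a; exact: lexx.
Qed.

(** A row [v] of [P] is a left eigenvector, so [v M G v^T = d v G v^T], and [v G v^T > 0] forces
    [d >= 0]. The rows are then permuted so that the eigenvalues decrease. *)
Lemma diagonalized_by_exists n (G M : 'M[R]_n) :
  sym_posdef G -> M *m G = G *m M^T ->
  (forall v : 'rV[R]_n, 0 <= (v *m M *m G *m v^T) 0 0) ->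
  exists (S : 'M[R]_n) (mu : 'rV[R]_n) (k : nat), diagonalized_by M S mu k.
Proof.
move=> Gpd MG Mpsd; have [P Pu [d PM]] := selfadjoint_diagonalizable Gpd MG.
have [s s_sort] := sorting_perm d.
have diagE (e : 'rV[R]_n) Q i : row i (diag_mx e *m Q) = e 0 i *: row i Q.
  by rewrite mul_diag_mx; apply/rowP => j; rewrite !mxE.
have Pi i : row i P *m M = d 0 i *: row i P by rewrite -row_mul PM diagE.
have d_ge0 i : 0 <= d 0 i.
  have := Mpsd (row i P); rewrite Pi -!scalemxAl mxE.
  have Pi0 : (row i P)^T != 0.
    apply: contraTneq Pu => Pi0; rewrite -row_free_unit; apply/negP =>
      /row_freeP[Q PQ].
    have : row i P *m Q = 0 by rewrite -[row i P]trmxK Pi0 trmx0 mul0mx.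
    rewrite -row_mul PQ => /matrixP/(_ 0 i)/eqP.
    by rewrite !mxE eqxx oner_eq0.
  by have := Gpd.2 _ Pi0; rewrite trmxK => /pmulr_lge0->.
pose mu := \row_i d 0 (s i); pose P' := row_perm s P.
have P'u : P' \in unitmx by rewrite /P' row_permE unitmx_mul unitmx_perm.
have P'M : P' *m M = diag_mx mu *m P'.
  apply/row_matrixP => i; rewrite row_mul diagE mxE.
  have -> : row i P' = row (s i) P by apply/rowP => j; rewrite !mxE.
  exact: Pi.
(* [k] will be the least index from which all sorted eigenvalues vanish. *)
have ex : exists k, [forall i : 'I_n, (k <= i)%N ==> (mu 0 i == 0)].
  by exists n; apply/forallP => i; rewrite leqNgt ltn_ord.
exists (invmx P'), mu, (ex_minn ex); case: ex_minnP => k /forallP k0 kmin;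
  split.
- by rewrite unitmx_inv.
- by rewrite invmxK -mulmxA -P'M mulKmx.
- by apply: kmin; apply/forallP => i; rewrite leqNgt ltn_ord.
- by move=> i j /s_sort; rewrite !mxE.
move=> i; split=> [ik|ki]; last by have /implyP/(_ ki)/eqP := k0 i.
(* If [mu_i] were 0, the later eigenvalues, nonnegative and at most [mu_i], would vanish too, and
   minimality would give [k <= i]. *)
rewrite lt0r mxE d_ge0 andbT; apply: contraTneq ik => i0; rewrite -leqNgt.
apply: kmin; apply/forallP => j; apply/implyP => /s_sort.
by rewrite i0 mxE => dj; rewrite eq_le d_ge0 dj.
Qed.

End SelfAdjoint.

(** * The flow of the sample covariance *)

Section SampleCovariance.
Variables (R : realType) (n J : nat) (u : 'I_J -> R -> 'cV[R]_n).

Lemma sample_cov_sym t : (sample_cov u t)^T = sample_cov u t.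
Proof.
rewrite /sample_cov linearZ /= raddf_sum /=; congr (_ *: _).
by apply: eq_bigr => j _; rewrite trmx_mul trmxK.
Qed.

Lemma sample_cov_psd t (x : 'cV[R]_n) : 0 <= (x^T *m sample_cov u t *m x) 0 0.
Proof.
rewrite /sample_cov -scalemxAr -scalemxAl mxE mulr_ge0 ?invr_ge0 //.
rewrite mulmx_sumr mulmx_suml summxE sumr_ge0 // => j _.
set v := u j t - _.
have -> : x^T *m (v *m v^T) *m x = (v^T *m x)^T *m (v^T *m x).
  by rewrite trmx_mul trmxK !mulmxA.
by rewrite mxE big_ord1 [X in X * _]mxE -expr2 sqr_ge0.
Qed.

End SampleCovariance.

Section CovarianceFlow.
Variables (R : realType) (m n J : nat).
Variables (A : 'M[R]_(m, n)) (Gamma : 'M[R]_m) (y : 'cV[R]_m).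
Variables (u0 : 'I_J -> 'cV[R]_n) (u : 'I_J -> R -> 'cV[R]_n).
Hypotheses (J_gt0 : (0 < J)%N) (Gamma_spd : sym_posdef Gamma).
Hypothesis u_sol : naive_EKI A Gamma y u0 u.

Let C := sample_cov u.
Let B : 'M[R]_n := A^T *m invmx Gamma *m A.

(** The covariance remains that of the particles, so the equation is affine in [f]. Particles and
    mean both solve it, and the solution formula and the limit are proved for any solution. *)
Definition EKI_flow (f : R -> 'cV[R]_n) : Prop := mderiv_ray f
  (fun t => - (sample_cov u t *m A^T *m invmx Gamma *m (A *m f t - y))).

Lemma EKI_flow_particle j : EKI_flow (u j).
Proof. by apply: has_deriv_ge0_ray => t; exact: u_sol.2. Qed.

(** An affine right-hand side commutes with averaging; [J > 0] makes the average of [J] copies of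
    [y] equal to [y]. *)
Lemma EKI_flow_mean : EKI_flow (sample_mean u).
Proof.
have dm := mderiv_rayZ (deriv_ray_cst (J%:R^-1))
                       (mderiv_ray_sum EKI_flow_particle).
apply: mderiv_ray_ext dm => // t _.
rewrite scale0r add0r sumrN scalerN -mulmx_sumr scalemxAr; congr (- (_ *m _)).
rewrite big_split /= sumrN sumr_const card_ord -mulmx_sumr scalerDr scalemxAr.
rewrite scalerN -[y *+ J]scaler_nat scalerA mulVf ?scale1r //.
by rewrite pnatr_eq0 -lt0n.
Qed.

Lemma EKI_flow_deviation j :
  mderiv_ray (fun t => u j t - sample_mean u t)
             (fun t => - (C t *m B *m (u j t - sample_mean u t))).
Proof.
have dN := mderiv_rayZ (deriv_ray_cst (-1)) EKI_flow_mean.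
apply: mderiv_ray_ext (mderiv_rayD (EKI_flow_particle j) dN) => t _.
  by rewrite scaleN1r.
rewrite scale0r add0r scaleN1r -opprD -mulmxBr; congr (- _).
by rewrite opprB addrA subrK -mulmxBr /B !mulmxA.
Qed.

(** For a deviation [v], the derivative of [v v^T] is [- C B v v^T - v v^T B C], the second term by
    symmetry of [B] and [C]; averaging turns [v v^T] into [C]. *)
Lemma sample_cov_riccati :
  mderiv_ray C (fun t => - (2 *: (C t *m B *m C t))).
Proof.
have BT : B^T = B.
  by rewrite /B !trmx_mul trmxK (posdef_inv Gamma_spd).1 mulmxA.
have dv j := mderiv_rayM (EKI_flow_deviation j)
  (mderiv_ray_tr (EKI_flow_deviation j)).
have dC := mderiv_rayZ (deriv_ray_cst (J%:R^-1)) (mderiv_ray_sum dv).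
apply: mderiv_ray_ext dC => // t _.
rewrite scale0r add0r big_split /=.
set v := fun j => u j t - sample_mean u t.
have CE : C t = J%:R^-1 *: \sum_j v j *m (v j)^T by [].
rewrite (eq_bigr (fun j => - (C t *m B *m (v j *m (v j)^T)))); last first.
  by move=> j _; rewrite mulNmx !mulmxA.
rewrite [X in _ + X](eq_bigr (fun j => - ((v j *m (v j)^T) *m (B *m C t))));
  last first.
  move=> j _; rewrite linearN /= mulmxN trmx_mul [(C t *m B)^T]trmx_mul BT
    sample_cov_sym.
  by rewrite !mulmxA.
rewrite !sumrN -mulmx_sumr -mulmx_suml scalerDr !scalerN scalemxAr.
rewrite [_ *: (_ *m (B *m _))]scalemxAl -CE.
by rewrite mulmxA -opprD scaler_nat mulr2n.
Qed.

(* Z := C P - 1 solves Z' = - 2 C B Z with Z(0) = 0, and Z^T B Z is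
   nonincreasing along this flow because C >= 0; hence B Z = 0 and Z' = 0. *)
Lemma sample_cov_inverse t : C 0 \in unitmx -> 0 <= t ->
  C t *m (invmx (C 0) + (2 * t) *: B) = 1%:M.
Proof.
move=> C0u.
pose P s := invmx (C 0) + (2 * s) *: B.
pose Z s := C s *m P s - 1%:M.
have BT : B^T = B.
  by rewrite /B !trmx_mul trmxK (posdef_inv Gamma_spd).1 mulmxA.
have dP : mderiv_ray P (fun=> 2 *: B).
  have d2 := deriv_rayM (deriv_ray_cst 2) (deriv_ray_id R).
  apply: mderiv_ray_ext (mderiv_rayD (mderiv_ray_cst _)
    (mderiv_rayZ d2 (mderiv_ray_cst B))) => // s _.
  by rewrite add0r mul0r add0r mulr1 scaler0 addr0.
have dZ : mderiv_ray Z (fun s => - (2 *: (C s *m B *m Z s))).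
  apply: mderiv_ray_ext (mderiv_rayD (mderiv_rayM sample_cov_riccati dP)
    (mderiv_ray_cst (- 1%:M))) => // s _.
  rewrite addr0 /Z mulmxBr mulmx1 mulNmx -scalemxAl.
  rewrite -[C s *m (2 *: B)]scalemxAr scalerBr opprB.
  by rewrite addrC !mulmxA.
have Z0 : Z 0 = 0 by rewrite /Z /P mulr0 scale0r addr0 mulmxV // subrr.
(* The diagonal of [Z^T B Z] holds the squared [Gamma]-norms of the columns of [A Z], which are
   nonnegative and bounded by their initial value 0. *)
have AZ s : 0 <= s -> A *m Z s = 0.
  move=> s0; apply: (posdef_diag_eq0 (posdef_inv Gamma_spd)) => i.
  have ZBZ r : (A *m Z r)^T *m invmx Gamma *m (A *m Z r)
    = (Z r)^T *m (B *m Z r).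
    by rewrite /B trmx_mul !mulmxA.
  apply/le_anti/andP; split; last first.
    by rewrite mulmx_col_entry (posdef_qform_ge0 (posdef_inv Gamma_spd)).
  rewrite ZBZ.
  have := mderiv_rayM (mderiv_ray_tr dZ) (mderiv_rayM (mderiv_ray_cst B) dZ).
  move=> /(_ i i)/deriv_ray_nincr/(_ _ s s0);
    rewrite Z0 !mulmx0 [X in _ <= X]mxE.
  apply=> r r0; rewrite mul0mx add0r; set X := B *m Z r.
  have dX : C r *m B *m Z r = C r *m X by rewrite -mulmxA.
  have XT : (Z r)^T *m B = X^T by rewrite trmx_mul BT.
  rewrite dX [(Z r)^T *m (B *m _)]mulmxA XT linearN linearZ /= trmx_mul.
  rewrite sample_cov_sym mulNmx mulmxN -scalemxAl -[X^T *m (2 *: _)]scalemxAr.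
  rewrite [X^T *m (C r *m X)]mulmxA -opprD mxE oppr_le0 mxE.
  rewrite [X in 0 <= X + _]mxE.
  by rewrite addr_ge0 // ?[X in 0 <= X]mxE mulr_ge0 //
    mulmx_col_entry sample_cov_psd.
move=> t0; apply/eqP; rewrite -subr_eq0 -/(P t) -/(Z t) -Z0; apply/eqP.
apply: (mderiv_ray_eq0 dZ) => // s s0.
by rewrite /B -!mulmxA AZ ?mulmx0 ?scaler0 ?oppr0 // ltW.
Qed.

End CovarianceFlow.

(** * The scalar equations and their decay *)

Section RayIntegral.
Variable R : realType.

(** The hypothesis on [f] provides the continuity of the integrand that the fundamental theorem of
    calculus asks for. *)
Lemma Rintegral_deriv_ray (F f f' : R -> R) t :
  deriv_ray F f -> deriv_ray f f' -> 0 <= t ->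
  (\int[lebesgue_measure]_(s in `[0, t]) f s)%R = F t - F 0.
Proof.
move=> dF df; rewrite le_eqVlt => /predU1P[<-|t0].
  by rewrite set_itv1 Rintegral_set1 subrr.
rewrite /Rintegral (@continuous_FTC2 _ f F) //.
- exact: derivable_oo_LRcontinuous_within (deriv_ray_LRcontinuous df t0).
- exact: deriv_ray_LRcontinuous dF t0.
move=> s; rewrite in_itv/= => /andP[s0 _].
by rewrite derive1E; have [_ ->] := dF.1 s s0.
Qed.

Lemma mx_integral_deriv_ray p q (F G G' : R -> 'M[R]_(p, q)) t :
  mderiv_ray F G -> mderiv_ray G G' -> 0 <= t ->
  mx_integral 0 t G = F t - F 0.
Proof.
move=> dF dG t0; apply/matrixP => i j.
by rewrite !mxE (Rintegral_deriv_ray (dF i j) (dG i j)).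
Qed.

Definition eigen_sqrt (mu t : R) : R := Num.sqrt (1 + 2 * t * mu).

(** The antiderivative of [1 / eigen_sqrt mu] that vanishes at 0. For [mu = 0] the quotient would
    return the default value 0 instead of [t]. *)
Definition eigen_int (mu t : R) : R :=
  if mu == 0 then t else (eigen_sqrt mu t - 1) / mu.

Section Eigenvalue.
Variable mu : R.
Hypothesis mu_ge0 : 0 <= mu.

Lemma eigen_lin_gt0 t : 0 <= t -> 0 < 1 + 2 * t * mu.
Proof. by move=> t0; rewrite ltr_pwDl // !mulr_ge0. Qed.

Lemma eigen_sqrt_gt0 t : 0 <= t -> 0 < eigen_sqrt mu t.
Proof. by move=> /eigen_lin_gt0; rewrite sqrtr_gt0. Qed.

Lemma eigen_sqrt_sqr t : 0 <= t -> eigen_sqrt mu t ^+ 2 = 1 + 2 * t * mu.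
Proof. by move=> /eigen_lin_gt0/ltW/sqr_sqrtr. Qed.

Lemma eigen_sqrt0 : eigen_sqrt mu 0 = 1.
Proof. by rewrite /eigen_sqrt mulr0 mul0r addr0 sqrtr1. Qed.

Lemma deriv_ray_eigen_sqrt :
  deriv_ray (eigen_sqrt mu) (fun t => mu / eigen_sqrt mu t).
Proof.
have dlin : deriv_ray (fun t => 1 + 2 * t * mu) (fun=> 2 * mu).
  apply: deriv_ray_ext (deriv_rayD (deriv_ray_cst 1) (deriv_rayM
    (deriv_rayM (deriv_ray_cst 2) (deriv_ray_id R))
    (deriv_ray_cst mu))) => // t _.
  by ring.
apply: deriv_ray_ext (deriv_ray_sqrt dlin eigen_lin_gt0) => // t /ltW t0.
rewrite -/(eigen_sqrt mu t); field; exact: lt0r_neq0 (eigen_sqrt_gt0 t0).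
Qed.

Lemma deriv_ray_eigen_sqrtV : deriv_ray (fun t => (eigen_sqrt mu t)^-1)
  (fun t => - (eigen_sqrt mu t) ^- 2 * (mu / eigen_sqrt mu t)).
Proof.
apply: deriv_rayV deriv_ray_eigen_sqrt _ => t t0.
exact: lt0r_neq0 (eigen_sqrt_gt0 t0).
Qed.

Lemma deriv_ray_eigen_int :
  deriv_ray (eigen_int mu) (fun t => (eigen_sqrt mu t)^-1).
Proof.
rewrite /eigen_int; have [mu0|mu0] := eqVneq mu 0.
  apply: deriv_ray_ext (deriv_ray_id R) => // t _.
  by rewrite /eigen_sqrt mu0 mulr0 addr0 sqrtr1 invr1.
apply: deriv_ray_ext (deriv_rayM (deriv_rayD deriv_ray_eigen_sqrt
  (deriv_ray_cst (-1))) (deriv_ray_cst mu^-1)) => // t /ltW t0.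
by field; rewrite mu0 lt0r_neq0 // eigen_sqrt_gt0.
Qed.

Lemma eigen_int0 : eigen_int mu 0 = 0.
Proof. by rewrite /eigen_int eigen_sqrt0 subrr mul0r; case: ifP. Qed.

(* w' = (e - mu w)/(1 + 2 t mu) has the integrating factor sqrt(1 + 2 t mu). *)
Lemma eigen_ode (w : R -> R) e :
  deriv_ray w (fun t => (e - mu * w t) / (1 + 2 * t * mu)) ->
  forall t, 0 <= t -> w t = (w 0 + e * eigen_int mu t) / eigen_sqrt mu t.
Proof.
move=> dw t t0.
(* The conserved quantity is [eigen_sqrt * w - e * eigen_int]; at time 0 it equals [w 0]. *)
have dd := deriv_rayD (deriv_rayM deriv_ray_eigen_sqrt dw)
                      (deriv_rayM (deriv_ray_cst (- e)) deriv_ray_eigen_int).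
have := deriv_ray_eq0 dd _ t0.
rewrite eigen_sqrt0 eigen_int0 mul1r mulr0 addr0 => <-.
  by field; exact: lt0r_neq0 (eigen_sqrt_gt0 t0).
move=> s /ltW s0; rewrite -(eigen_sqrt_sqr s0).
by field; exact: lt0r_neq0 (eigen_sqrt_gt0 s0).
Qed.

End Eigenvalue.
End RayIntegral.

(** * Decay of order [1 / sqrt t] *)

Section Decay.
Variable R : realType.

(** The bound holds for every [t > 0] rather than eventually, so constants add up without any
    comparison of thresholds. *)
Definition sqrt_decay (f : R -> R) : Prop :=
  exists2 K, 0 <= K & forall t, 0 < t -> `|f t| <= K / Num.sqrt t.

Definition msqrt_decay p q (F : R -> 'M[R]_(p, q)) : Prop :=
  forall i j, sqrt_decay (fun t => F t i j).

Lemma sqrt_decay0 : sqrt_decay (fun=> 0).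
Proof. by exists 0 => // t _; rewrite normr0 mul0r. Qed.

Lemma sqrt_decayD f g : sqrt_decay f -> sqrt_decay g ->
  sqrt_decay (fun t => f t + g t).
Proof.
move=> [K K0 fK] [L L0 gL]; exists (K + L); first exact: addr_ge0.
move=> t t0; rewrite mulrDl; apply: le_trans (ler_normD _ _) _.
by rewrite lerD ?fK ?gL.
Qed.

Lemma sqrt_decayZ a f : sqrt_decay f -> sqrt_decay (fun t => a * f t).
Proof.
move=> [K K0 fK]; exists (`|a| * K); first exact: mulr_ge0.
by move=> t t0; rewrite normrM -mulrA ler_wpM2l ?fK.
Qed.

Lemma sqrt_decay_ext f g : (forall t, 0 < t -> f t = g t) ->
  sqrt_decay f -> sqrt_decay g.
Proof. by move=> fg [K K0 fK]; exists K => // t t0; rewrite -fg ?fK. Qed.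

Lemma sqrt_decay_sum (I : Type) (r : seq I) (f : I -> R -> R) :
  (forall i, sqrt_decay (f i)) -> sqrt_decay (fun t => \sum_(i <- r) f i t).
Proof.
move=> fd; elim: r => [|i r IH].
  by apply: sqrt_decay_ext sqrt_decay0 => t _; rewrite big_nil.
by apply: sqrt_decay_ext (sqrt_decayD (fd i) IH) => t _; rewrite big_cons.
Qed.

Lemma msqrt_decay_ext p q (F G : R -> 'M[R]_(p, q)) :
  (forall t, 0 < t -> F t = G t) -> msqrt_decay F -> msqrt_decay G.
Proof.
by move=> FG dF i j; apply: sqrt_decay_ext (dF i j) => t t0; rewrite FG.
Qed.

Lemma msqrt_decay_mull p q r (A : 'M[R]_(p, q)) (F : R -> 'M[R]_(q, r)) :
  msqrt_decay F -> msqrt_decay (fun t => A *m F t).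
Proof.
move=> dF i j; apply: sqrt_decay_ext (sqrt_decay_sum (index_enum _)
  (fun k => sqrt_decayZ (A i k) (dF k j))) => t _.
by rewrite mxE.
Qed.

Lemma msqrt_decay_mulr p q r (F : R -> 'M[R]_(p, q)) (A : 'M[R]_(q, r)) :
  msqrt_decay F -> msqrt_decay (fun t => F t *m A).
Proof.
move=> dF i j; apply: sqrt_decay_ext (sqrt_decay_sum (index_enum _)
  (fun k => sqrt_decayZ (A k j) (dF i k))) => t _.
by rewrite mxE; apply: eq_bigr => k _; rewrite mulrC.
Qed.

Lemma msqrt_decay_diag n (F : R -> 'rV[R]_n) :
  msqrt_decay F -> msqrt_decay (fun t => diag_mx (F t)).
Proof.
move=> dF i j; have [<-|ij] := eqVneq i j.
  by apply: sqrt_decay_ext (dF 0 i) => t _; rewrite mxE eqxx.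
by apply: sqrt_decay_ext sqrt_decay0 => t _; rewrite mxE (negPf ij).
Qed.

(** The matrix norm is the largest absolute value of an entry, so the sum of the entrywise constants
    works. *)
Lemma msqrt_decay_norm p q (F : R -> 'M[R]_(p, q)) : msqrt_decay F ->
  exists2 K, 0 <= K & forall t, 0 < t -> `|F t| <= K / Num.sqrt t.
Proof.
move=> dF.
have [K KF] : {K : 'I_p * 'I_q -> R & forall ij, 0 <= K ij /\
    forall t, 0 < t -> `|F t ij.1 ij.2| <= K ij / Num.sqrt t}.
  apply: (@choice _ _ (fun ij Kij => 0 <= Kij /\
    forall t, 0 < t -> `|F t ij.1 ij.2| <= Kij / Num.sqrt t)) => ij.
  by have [Kij ? ?] := dF ij.1 ij.2; exists Kij.
have sumK0 P : 0 <= \sum_(ij | P ij) K ij.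
  by apply: sumr_ge0 => ij _; have [] := KF ij.
exists (\sum_ij K ij) => // t t0.
have st : 0 <= (Num.sqrt t)^-1 by rewrite invr_ge0 sqrtr_ge0.
rewrite [leLHS]/Num.norm /= mx_normrE.
apply: bigmax_le => [|ij _]; first exact: mulr_ge0.
apply: le_trans ((KF ij).2 t t0) _; rewrite ler_wpM2r //.
by rewrite (bigD1 ij) //= lerDl.
Qed.

Lemma msqrt_decay_cvg p q (F : R -> 'M[R]_(p, q)) L :
  msqrt_decay (fun t => F t - L) -> F t @[t --> +oo] --> L.
Proof.
move=> /msqrt_decay_norm[K K0 FK]; apply/cvgrPdist_le => e e0; near=> t.
have t0 : 0 < t by near: t; exact: nbhs_pinfty_gt.
rewrite distrC; apply: le_trans (FK t t0) _.
rewrite ler_pdivrMr ?sqrtr_gt0 // mulrC -ler_pdivrMr //.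
(* The bound is at most [e] as soon as [t >= (K / e)^2]. *)
rewrite -[leLHS]ger0_norm ?divr_ge0 // ?(ltW e0) // -sqrtr_sqr.
apply: ler_wsqrtr.
by near: t; apply: nbhs_pinfty_ge; exact: num_real.
Unshelve. all: by end_near. Qed.

Lemma msqrt_decay_rate p q (F : R -> 'M[R]_(p, q)) L :
  msqrt_decay (fun t => F t - L) ->
  exists K : R, \forall t \near +oo, `|F t - L| <= K / Num.sqrt t.
Proof.
move=> /msqrt_decay_norm[K _ FK]; exists K; near=> t; apply: FK.
by near: t; exact: nbhs_pinfty_gt.
Unshelve. all: by end_near. Qed.

(** The constant [1 / sqrt (2 mu)] comes from [1 + 2 t mu >= 2 t mu]. *)
Lemma sqrt_decay_eigen (mu : R) : 0 < mu ->
  sqrt_decay (fun t => (eigen_sqrt mu t)^-1).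
Proof.
move=> mu0; exists (Num.sqrt (2 * mu))^-1; first by rewrite invr_ge0 sqrtr_ge0.
move=> t t0; have m0 : 0 < 2 * mu by rewrite mulr_gt0.
rewrite -invfM -sqrtrM ?(ltW m0) // ger0_norm ?invr_ge0 ?sqrtr_ge0 //.
rewrite lef_pV2 ?posrE ?eigen_sqrt_gt0 ?sqrtr_gt0 ?mulr_gt0 //
  ?(ltW mu0) ?(ltW t0) //.
by rewrite ler_wsqrtr // mulrAC lerDr.
Qed.

End Decay.

(** * Weighted minimization *)

Section Minimization.
Variables (R : realType) (m n : nat).

(** If [A a] and [A b] both qualify, [A (b - a)] is the difference of two residuals orthogonal to
    the range, hence orthogonal to itself and zero: [xget] has a single candidate. *)
Lemma orth_projP (Gamma : 'M[R]_m) (A : 'M[R]_(m, n)) z q :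
  sym_posdef Gamma -> range (mulmx A) q ->
  (forall v : 'cV[R]_n, dotH Gamma (A *m v) (z - q) = 0) ->
  orth_proj Gamma (range (mulmx A)) z = q.
Proof.
move=> Gpd [a _ <-] qz; rewrite /orth_proj; case: xgetP =>
  [p pE [[b _ bp] pz]|].
  apply/eqP; rewrite -bp -subr_eq0 -mulmxBr; apply/eqP.
  apply: (posdef_qform_eq0 (posdef_inv Gpd)).
  have := qz (b - a); have := pz (A *m (b - a)).
  rewrite -bp => /(_ (ex_intro2 _ _ _ I erefl)) pz' qz'.
  move: pz' qz'; rewrite /dotH; set X := _ *m invmx Gamma => pz' qz'.
  have -> : A *m (b - a) = (z - A *m a) - (z - A *m b).
    by rewrite mulmxBr [RHS]addrC opprB addrA subrK.
  by rewrite mulmxBr [LHS]mxE [X in _ + X]mxE pz' qz' subrr.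
move=> /(_ (A *m a))/not_andP[|].
  by case; exists a.
by case=> _ [v _ <-]; exact: qz.
Qed.

(* The difference of w and any feasible v lies in ker A, which is orthogonal
   to w - u0 in ran(C0 A^T) for the weighted inner product. *)
Lemma argmin_normH (C0 : 'M[R]_n) (A : 'M[R]_(m, n)) u0 w z b :
  sym_posdef C0 -> A *m w = b -> w - u0 = C0 *m A^T *m z ->
  argmin (fun v => normH C0 (v - u0)) [set v : 'cV[R]_n | A *m v = b] = [set w].
Proof.
move=> Cpd Aw wz; have Ipd := posdef_inv Cpd.
have pyth v : A *m v = b ->
    dotH C0 (v - u0) (v - u0)
      = dotH C0 (w - u0) (w - u0) + dotH C0 (v - w) (v - w).
  move=> Av; have -> : v - u0 = (w - u0) + (v - w).
    by rewrite [RHS]addrC addrA subrK.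
  have orth : (v - w)^T *m invmx C0 *m (w - u0) = 0.
    rewrite wz !mulmxA mulmxKV ?posdef_unitmx // -trmx_mul.
    by rewrite mulmxBr Av Aw subrr trmx0 mul0mx.
  have orthT : (w - u0)^T *m invmx C0 *m (v - w) = 0.
    by apply: trmx_inj; rewrite !trmx_mul trmxK Ipd.1 mulmxA orth trmx0.
  rewrite /dotH; move: (w - u0) (v - w) orth orthT => p q orth orthT.
  by rewrite [(p + q)^T]linearD /= !mulmxDl !mulmxDr orth orthT addr0 add0r mxE.
have dot_ge0 v : 0 <= dotH C0 v v by exact: posdef_qform_ge0.
apply/seteqP; split=> [v [Av vmin]|_ ->] /=; last first.
  by split=> // v Av; rewrite /normH ler_wsqrtr // (pyth v Av) lerDl.
have := vmin w Aw; rewrite /normH ler_sqrt // (pyth v Av) gerDl => vw.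
apply/eqP; rewrite -subr_eq0; apply/eqP/(posdef_qform_eq0 Ipd).
by apply/le_anti; rewrite vw dot_ge0.
Qed.

End Minimization.

(** * Spectral calculus for [C_0 A^T Gamma^-1 A], and its pseudo-inverse *)

Section DiagConj.
Variables (R : realType) (n : nat) (S : 'M[R]_n).
Hypothesis Su : S \in unitmx.
Implicit Types a b : 'rV[R]_n.

Lemma diag_conjM a b :
  diag_conj S a *m diag_conj S b = diag_conj S (\row_i (a 0 i * b 0 i)).
Proof.
rewrite /diag_conj !mulmxA mulmxKV // -[S *m _ *m _]mulmxA mulmx_diag.
by congr (_ *m diag_mx _ *m _); apply/rowP => i; rewrite !mxE.
Qed.

Lemma diag_conjB a b : diag_conj S a - diag_conj S b = diag_conj S (a - b).
Proof. by rewrite /diag_conj -mulmxBl -mulmxBr -linearB. Qed.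

Lemma diag_conj1 a : (forall i, a 0 i = 1) -> diag_conj S a = 1%:M.
Proof.
move=> a1; have -> : a = const_mx 1 by apply/rowP => i; rewrite a1 mxE.
by rewrite /diag_conj diag_const_mx mulmx1 mulmxV.
Qed.

Lemma diag_conj0 a : (forall i, a 0 i = 0) -> diag_conj S a = 0.
Proof.
move=> a0; have -> : a = 0 by apply/rowP => i; rewrite a0 mxE.
by rewrite /diag_conj linear0 mulmx0 mul0mx.
Qed.

Lemma eq_diag_conj a b :
  (forall i, a 0 i = b 0 i) -> diag_conj S a = diag_conj S b.
Proof. by move=> ab; congr diag_conj; apply/rowP. Qed.

End DiagConj.

Section Spectral.
Variables (R : realType) (m n : nat) (A : 'M[R]_(m, n)) (Gamma : 'M[R]_m).
Variables (C0 S : 'M[R]_n) (mu : 'rV[R]_n) (k : nat).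
Hypotheses (Gamma_spd : sym_posdef Gamma) (C0_spd : sym_posdef C0).
Let K : 'M[R]_(n, m) := C0 *m A^T *m invmx Gamma.
Hypothesis MS : diagonalized_by (K *m A) S mu k.

(** The spectral projection onto the kernel of [K A] along its range; it turns out to be the limit
    of [C(t) C_0^-1]. *)
Definition null_proj : 'M[R]_n := diag_conj S (\row_i (mu 0 i == 0)%:R).

Let Su : S \in unitmx. Proof. by case: MS. Qed.

Let ME : K *m A = diag_conj S mu. Proof. by case: MS. Qed.

Lemma eigenvalue_ge0 i : 0 <= mu 0 i.
Proof.
by case: MS => _ _ _ _ /(_ i)[]; case: (ltnP i k) => [_ /(_ isT)/ltW|_ _ ->].
Qed.

(** With [P = null_proj], the diagonal form gives [K A P = 0], so [(A P)^T Gamma^-1 (A P) = P^T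
    C_0^-1 (K A P) = 0], and [Gamma^-1] is definite. *)
Lemma mul_null_proj : A *m null_proj = 0.
Proof.
apply: (posdef_mul_eq0 (posdef_inv Gamma_spd)).
have MPi : K *m A *m null_proj = 0.
  rewrite ME diag_conjM // diag_conj0 // => i; rewrite !mxE.
  by case: eqP => [->|_]; rewrite ?mul0r ?mulr0.
have -> : (A *m null_proj)^T *m invmx Gamma *m (A *m null_proj)
    = null_proj^T *m invmx C0 *m (K *m A *m null_proj).
  by rewrite trmx_mul /K !mulmxA mulmxKV ?posdef_unitmx.
by rewrite MPi mulmx0.
Qed.

(** Dually, [Y = P C_0 A^T] satisfies [Y Gamma^-1 Y^T = P K A C_0 P^T = 0]. This removes the noise
    from the eigencoordinates with eigenvalue 0. *)
Lemma null_proj_mul : null_proj *m K = 0.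
Proof.
suff Y0 : (null_proj *m C0 *m A^T)^T = 0.
  have := congr1 trmx Y0; rewrite trmxK trmx0 /K !mulmxA => ->.
  by rewrite mul0mx.
apply: (posdef_mul_eq0 (posdef_inv Gamma_spd)).
have PiM : null_proj *m (K *m A) = 0.
  rewrite ME diag_conjM // diag_conj0 // => i; rewrite !mxE.
  by case: eqP => [->|_]; rewrite ?mul0r ?mulr0.
rewrite trmxK 2!trmx_mul trmxK C0_spd.1 !mulmxA.
by move: PiM; rewrite /K !mulmxA => ->; rewrite !mul0mx.
Qed.

Lemma mul_pinv : K *m A *m diag_pinv S mu = 1%:M - null_proj.
Proof.
rewrite ME diag_conjM // -(@diag_conj1 _ _ _ Su (const_mx 1)); last first.
  by move=> i; rewrite mxE.
rewrite diag_conjB; apply: eq_diag_conj => i; rewrite !mxE.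
by have [->|mu0] := eqVneq (mu 0 i) 0; rewrite ?mul0r ?subrr // subr0 mulfV.
Qed.

(** With [M = K A], the form [M M^+ M^+] shows that the range of [M^+] lies in that of [C_0 A^T], as
    the minimization criterion requires. *)
Lemma pinv_mul_pinv : diag_pinv S mu
  = K *m A *m diag_pinv S mu *m diag_pinv S mu.
Proof.
rewrite ME !diag_conjM //; apply: eq_diag_conj => i; rewrite !mxE.
by have [->|mu0] := eqVneq (mu 0 i) 0; rewrite ?invr0 ?mulr0 // mulfV // mul1r.
Qed.

Section Feasible.
Variables f0 x : 'cV[R]_n.
Let fdag : 'cV[R]_n := f0 + (1%:M - null_proj) *m (x - f0).

Lemma mul_fdag : A *m fdag = A *m x.
Proof.
by rewrite mulmxDr [A *m (_ *m _)]mulmxA [A *m (_ - _)]mulmxBr mulmx1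
  mul_null_proj subr0 mulmxBr addrC subrK.
Qed.

Lemma argmin_fdag : argmin (fun v => normH C0 (v - f0))
  [set v : 'cV[R]_n | A *m v = A *m x] = [set fdag].
Proof.
(* This [z] gives [C_0 A^T z = M M^+ (x - f0) = (1 - null_proj) (x - f0)]. *)
apply: (argmin_normH (z := invmx Gamma *m A *m diag_pinv S mu *m (x - f0))
  C0_spd mul_fdag).
by rewrite /fdag addrC addKr -mul_pinv /K !mulmxA.
Qed.

Variables eps y : 'cV[R]_m.
Hypothesis yE : y = A *m x + eps.
Let flim : 'cV[R]_n :=
  fdag + diag_pinv S mu *m C0 *m (A^T *m invmx Gamma *m eps).

Let flimE : flim = fdag + diag_pinv S mu *m (K *m eps).
Proof. by rewrite /flim /K !mulmxA. Qed.

Let mul_flim : A *m flim = A *m x + A *m (diag_pinv S mu *m (K *m eps)).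
Proof. by rewrite flimE mulmxDr mul_fdag. Qed.

(** After multiplication by [C_0], the normal equation [A^T Gamma^-1 (y - A flim) = 0] becomes [K
    eps - M M^+ K eps = null_proj K eps = 0]. *)
Lemma orth_proj_flim : orth_proj Gamma (range (mulmx A)) y = A *m flim.
Proof.
apply: orth_projP => // v.
rewrite /dotH trmx_mul -!mulmxA.
have -> : A^T *m (invmx Gamma *m (y - A *m flim)) = 0.
  have -> : A^T *m (invmx Gamma *m (y - A *m flim))
      = invmx C0 *m (K *m (y - A *m flim)).
    by rewrite /K !mulmxA mulVmx ?posdef_unitmx // mul1mx.
  rewrite mul_flim yE opprD addrACA subrr add0r mulmxBr.
  rewrite [A *m _]mulmxA [K *m (_ *m _)]mulmxA [K *m (A *m _)]mulmxA mul_pinv.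
  by rewrite mulmxBl mul1mx [null_proj *m _]mulmxA null_proj_mul mul0mx subr0
    subrr mulmx0.
by rewrite mulmx0 mxE.
Qed.

Lemma argmin_flim : argmin (fun v => normH C0 (v - f0))
  [set v : 'cV[R]_n | A *m v = orth_proj Gamma (range (mulmx A)) y]
    = [set flim].
Proof.
rewrite orth_proj_flim.
(* Here [C_0 A^T z = (1 - null_proj) (x - f0) + M^+ K eps], which is [flim - f0]. *)
apply: (argmin_normH (z := invmx Gamma *m A *m diag_pinv S mu *m (x - f0 +
  diag_pinv S mu *m (K *m eps))) C0_spd erefl).
have -> : C0 *m A^T *m (invmx Gamma *m A *m diag_pinv S mu *m
      (x - f0 + diag_pinv S mu *m (K *m eps)))
    = K *m A *m diag_pinv S mu *m (x - f0 + diag_pinv S mu *m (K *m eps)).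
  by rewrite /K !mulmxA.
rewrite mulmxDr [_ *m (diag_pinv S mu *m _)]mulmxA -pinv_mul_pinv mul_pinv.
by rewrite flimE /fdag addrC -addrA addKr.
Qed.

End Feasible.
End Spectral.

(** * Explicit solution and limit *)

Section Flow.
Variables (R : realType) (m n J : nat).
Variables (A : 'M[R]_(m, n)) (Gamma : 'M[R]_m) (y eps : 'cV[R]_m).
Variables (u0 : 'I_J -> 'cV[R]_n) (u : 'I_J -> R -> 'cV[R]_n) (x : 'cV[R]_n).
Hypotheses (J_gt0 : (0 < J)%N) (Gamma_spd : sym_posdef Gamma).
Hypothesis yE : y = A *m x + eps.
Hypothesis u_sol : naive_EKI A Gamma y u0 u.
Hypothesis C0_spd : sym_posdef (sample_cov u 0).
Let C0 := sample_cov u 0.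
Let K : 'M[R]_(n, m) := C0 *m A^T *m invmx Gamma.
Variables (S : 'M[R]_n) (mu : 'rV[R]_n) (k : nat).
Hypothesis MS : diagonalized_by (K *m A) S mu k.
Let Q : R -> 'M[R]_n := sqrtCC0 S mu.

Let Su : S \in unitmx. Proof. by case: MS. Qed.

Let ME : K *m A = diag_conj S mu. Proof. by case: MS. Qed.

Let mu_ge0 i : 0 <= mu 0 i. Proof. exact: eigenvalue_ge0 MS i. Qed.

(** The inverse formula reads [C(t) C_0^-1 (1 + 2 t K A) = 1], and [S] diagonalizes the last
    factor. *)
Lemma sample_cov_diag t : 0 <= t ->
  sample_cov u t *m invmx C0 = diag_conj S (\row_i (1 + 2 * t * mu 0 i)^-1).
Proof.
move=> t0; have C0u := posdef_unitmx C0_spd.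
have CP := sample_cov_inverse J_gt0 Gamma_spd u_sol C0u t0.
set lam := \row_i (1 + 2 * t * mu 0 i)^-1.
pose a := \row_i (1 + 2 * t * mu 0 i).
have {}CP : sample_cov u t *m invmx C0 *m diag_conj S a = 1%:M.
  rewrite -CP -mulmxA; congr (_ *m _).
  have -> : diag_conj S a = 1%:M + (2 * t) *: (K *m A).
    rewrite ME -(@diag_conj1 _ _ _ Su (const_mx 1)); last by move=> i;
      rewrite mxE.
    rewrite /diag_conj scalemxAl scalemxAr -mulmxDl -mulmxDr;
      congr (_ *m _ *m _).
    apply/matrixP => i j; rewrite !mxE; case: eqP => _;
      first by rewrite !mulr1n.
    by rewrite !mulr0n mulr0 addr0.
  by rewrite mulmxDr mulmx1 -scalemxAr /K !mulmxA mulVmx // mul1mx.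
have aM : diag_conj S a *m diag_conj S lam = 1%:M.
  rewrite diag_conjM // diag_conj1 // => i; rewrite !mxE mulfV //.
  by rewrite lt0r_neq0 // eigen_lin_gt0.
by rewrite -[LHS]mulmx1 -aM mulmxA CP mul1mx.
Qed.

Lemma mx_integral_sqrtCC0 t : 0 <= t ->
  mx_integral 0 t Q = diag_conj S (\row_i eigen_int (mu 0 i) t).
Proof.
have conj_ray (a a' : 'I_n -> R -> R) : (forall i, deriv_ray (a i) (a' i)) ->
    mderiv_ray (fun t => diag_conj S (\row_i a i t))
               (fun t => diag_conj S (\row_i a' i t)).
  move=> da; have dD : mderiv_ray (fun t => diag_mx (\row_i a i t))
                                  (fun t => diag_mx (\row_i a' i t)).
    move=> i j; have [<-|ij] := eqVneq i j.
      by apply: deriv_ray_ext (da i) => s _; rewrite !mxE eqxx.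
    by apply: deriv_ray_ext (deriv_ray_cst 0) => s _; rewrite !mxE (negPf ij).
  apply: mderiv_ray_ext (mderiv_rayM (mderiv_rayM (mderiv_ray_cst S) dD)
    (mderiv_ray_cst (invmx S))) => // s _.
  by rewrite mul0mx add0r mulmx0 addr0.
move=> t0; rewrite (mx_integral_deriv_ray
  (conj_ray _ _ (fun i => deriv_ray_eigen_int (mu_ge0 i)))
  (conj_ray _ _ (fun i => deriv_ray_eigen_sqrtV (mu_ge0 i))) t0).
by rewrite [X in _ - X]diag_conj0 ?subr0 // => i; rewrite mxE eigen_int0.
Qed.

Variable f : R -> 'cV[R]_n.
Hypothesis f_flow : EKI_flow A Gamma y u f.

Let w t := invmx S *m (f t - x).
Let e := invmx S *m (K *m eps).

Lemma EKI_flow_coord i t : 0 <= t ->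
  w t i 0 = (w 0 i 0 + e i 0 * eigen_int (mu 0 i) t) / eigen_sqrt (mu 0 i) t.
Proof.
apply: (eigen_ode (mu_ge0 i) (w := fun t => w t i 0)).
have dw := mderiv_rayM (mderiv_ray_cst (invmx S))
  (mderiv_rayD f_flow (mderiv_ray_cst (- x))).
apply: deriv_ray_ext (dw i 0) => // s /ltW s0.
rewrite mul0mx add0r addr0.
(* Since [A f - y = A (f - x) - eps] and [C = (C C_0^-1) C_0], the drift is diagonal in the
   coordinates [w]. *)
have -> : sample_cov u s *m A^T *m invmx Gamma *m (A *m f s - y)
    = S *m (diag_mx (\row_i (1 + 2 * s * mu 0 i)^-1)
            *m (diag_mx mu *m w s - e)).
  have -> : A *m f s - y = A *m (f s - x) - eps.
    by rewrite yE mulmxBr opprD addrA.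
  have -> : sample_cov u s *m A^T *m invmx Gamma
    = sample_cov u s *m invmx C0 *m K.
    by rewrite /K !mulmxA mulmxKV // posdef_unitmx.
  rewrite sample_cov_diag // -mulmxA mulmxBr [K *m (A *m _)]mulmxA ME
    /diag_conj.
  by rewrite -!mulmxA [invmx S *m (_ - _)]mulmxBr [invmx S *m (S *m _)]mulKmx
    // /e /K -!mulmxA.
have rhsE : (diag_mx mu *m w s - e) i 0 = mu 0 i * w s i 0 - e i 0.
  by rewrite mul_diag_mx [LHS]mxE [X in X + _]mxE [X in _ + X]mxE.
rewrite mulmxN mulKmx // mxE mul_diag_mx [X in - X]mxE rhsE mxE.
by rewrite -mulrN opprB mulrC.
Qed.

Lemma EKI_flow_solution t : 0 <= t ->
  f t = f 0 + (1%:M - Q t) *m (x - f 0)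
        + Q t *m mx_integral 0 t Q *m (K *m eps).
Proof.
move=> t0; rewrite mx_integral_sqrtCC0 //.
(* Centred at [x], both sides can be compared coordinate by coordinate. *)
have -> : f 0 + (1%:M - Q t) *m (x - f 0) = x + Q t *m (f 0 - x).
  by rewrite mulmxBl mul1mx addrA [f 0 + (x - f 0)]addrC subrK -mulmxN opprB.
rewrite -addrA -mulmxA -mulmxDr.
have -> : f t = x + S *m w t by rewrite mulKVmx // addrC subrK.
congr (_ + _); rewrite /Q /sqrtCC0 /diag_conj -!mulmxA; congr (_ *m _).
rewrite mulmxDr [invmx S *m (S *m _)]mulKmx //.
have -> : invmx S *m (C0 *m (A^T *m (invmx Gamma *m eps))) = e.
  by rewrite /e /K -!mulmxA.
apply/matrixP => i j; rewrite (ord1 j) EKI_flow_coord // -/(w 0).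
move: (w 0) e => w0 e'; rewrite !mul_diag_mx !mxE -/(eigen_sqrt _ _).
by rewrite mulrC [e' i 0 * _]mulrC.
Qed.

Definition EKI_limit : 'cV[R]_n :=
  f 0 + (1%:M - null_proj S mu) *m (x - f 0)
  + diag_pinv S mu *m C0 *m (A^T *m invmx Gamma *m eps).

(** In coordinate [i] the error is [(w_i(0) - e_i / mu_i) / sqrt (1 + 2 t mu_i)] if [mu_i > 0], and
    0 if [mu_i = 0], because then [e_i = 0]. *)
Lemma EKI_flow_decay : msqrt_decay (fun t => f t - EKI_limit).
Proof.
(* [phi] is 0 where [mu_i = 0], which makes the default value of [e_i / 0] inside [c] harmless. *)
pose phi i t : R := if mu 0 i == 0 then 0 else (eigen_sqrt (mu 0 i) t)^-1.
pose c : 'cV[R]_n := \col_i (w 0 i 0 - e i 0 / mu 0 i).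
have dphi : msqrt_decay (fun t => diag_mx (\row_i phi i t)).
  apply: msqrt_decay_diag => r i; rewrite /phi.
  have [mui|mui] := eqVneq (mu 0 i) 0.
    by apply: sqrt_decay_ext (sqrt_decay0 R) => t _; rewrite mxE mui eqxx.
  have mupos : 0 < mu 0 i by rewrite lt0r mui mu_ge0.
  by apply: sqrt_decay_ext (sqrt_decay_eigen mupos) => t _;
    rewrite mxE (negPf mui).
apply: msqrt_decay_ext (msqrt_decay_mull S (msqrt_decay_mulr c dphi)) => t t0.
have -> : f t = x + S *m w t by rewrite mulKVmx // addrC subrK.
have -> : EKI_limit = x + S *m (diag_mx (\row_i (mu 0 i == 0)%:R) *m w 0
    + diag_mx (\row_i (mu 0 i)^-1) *m e).
  rewrite /EKI_limit [S *m (_ + _)]mulmxDr addrA; congr (_ + _).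
    rewrite mulmxBl mul1mx addrA [f 0 + (x - f 0)]addrC subrK -mulmxN opprB.
    by rewrite /null_proj /diag_conj -!mulmxA.
  by rewrite /diag_pinv /diag_conj /e /K -!mulmxA.
rewrite opprD addrACA subrr add0r -mulmxBr; congr (_ *m _).
have e0 i : mu 0 i = 0 -> e i 0 = 0.
  move=> mui; have : invmx S *m (null_proj S mu *m K *m eps) = 0.
    by rewrite (null_proj_mul Gamma_spd C0_spd MS) mul0mx mulmx0.
  rewrite -mulmxA /null_proj /diag_conj -[_ *m invmx S *m _]mulmxA -/e.
  rewrite -[S *m _ *m e]mulmxA mulKmx // => /matrixP/(_ i 0).
  rewrite mul_diag_mx mxE [X in X * _]mxE mui eqxx mul1r.
  by rewrite [X in _ = X -> _]mxE.
apply/matrixP => i j; rewrite (ord1 j).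
move: (EKI_flow_coord i (ltW t0)) (e0 i); rewrite /c.
move: (w t) (w 0) e => wt w0 e' wtE e'0; rewrite !mul_diag_mx !mxE wtE.
rewrite /phi /eigen_int; have [mui|mui] := eqVneq (mu 0 i) 0.
  by rewrite e'0 // /eigen_sqrt mui mulr0 addr0 sqrtr1 !mul0r mulr0 mul1r
    !addr0 divr1 subrr.
have r0 : eigen_sqrt (mu 0 i) t != 0.
  by rewrite lt0r_neq0 // eigen_sqrt_gt0 // ltW.
by rewrite mul0r add0r; field; rewrite mui r0.
Qed.

Lemma sample_cov_decay :
  msqrt_decay (fun t => sample_cov u t - null_proj S mu *m C0).
Proof.
pose phi i t : R := if mu 0 i == 0 then 0 else (1 + 2 * t * mu 0 i)^-1.
have dphi : msqrt_decay (fun t => diag_mx (\row_i phi i t)).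
  apply: msqrt_decay_diag => r i; rewrite /phi.
  have [mui|mui] := eqVneq (mu 0 i) 0.
    by apply: sqrt_decay_ext (sqrt_decay0 R) => t _; rewrite mxE mui eqxx.
  have mupos : 0 < mu 0 i by rewrite lt0r mui mu_ge0.
  have [L L0 mL] := sqrt_decay_eigen mupos; exists L => // t t0.
  rewrite mxE (negPf mui); apply: le_trans (mL t t0).
  have s0 := eigen_sqrt_gt0 (mu_ge0 i) (ltW t0).
  (* The coordinates decay like [1 / t]; since [eigen_sqrt >= 1], its inverse square is bounded by
     its inverse. *)
  have s1 : 1 <= eigen_sqrt (mu 0 i) t.
    by rewrite -[leLHS]sqrtr1 ler_wsqrtr // lerDl !mulr_ge0 // ltW.
  rewrite -(eigen_sqrt_sqr (mu_ge0 i) (ltW t0)) !normfV.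
  rewrite !ger0_norm ?exprn_ge0 // ?(ltW s0) //.
  by rewrite lef_pV2 ?posrE ?exprn_gt0 // expr2 ler_peMl // ltW.
apply: msqrt_decay_ext (msqrt_decay_mulr C0
  (msqrt_decay_mulr (invmx S) (msqrt_decay_mull S dphi))) => t /ltW t0.
rewrite -[sample_cov u t](mulmxKV (posdef_unitmx C0_spd)) sample_cov_diag //.
rewrite -mulmxBl; congr (_ *m _); rewrite diag_conjB; apply: eq_diag_conj => i.
rewrite !mxE /phi; case: eqP => [->|_]; last by rewrite subr0.
by rewrite mulr0 addr0 invr1 subrr.
Qed.

End Flow.

Theorem theorem3p1 (R : realType) (m n J : nat)
    (A : 'M[R]_(m, n)) (Gamma : 'M[R]_m) (y ydag eps : 'cV[R]_m)
    (u0 : 'I_J -> 'cV[R]_n) (u : 'I_J -> R -> 'cV[R]_n) (x : 'cV[R]_n)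
    (J_gt0 : (0 < J)%N)
    (Gamma_spd : sym_posdef Gamma)
    (ydag_ran : range (mulmx A) ydag)
    (yE : y = ydag + eps)
    (u_sol : naive_EKI A Gamma y u0 u)
    (C0_spd : sym_posdef (sample_cov u 0))
    (xE : A *m x = ydag) :
  let E : 'M[R]_n := 1%:M in
  let mean : R -> 'cV[R]_n := sample_mean u in
  let C : R -> 'M[R]_n := sample_cov u in
  let m0 : 'cV[R]_n := mean 0 in
  let C0 : 'M[R]_n := C 0 in
  let M : 'M[R]_n := C0 *m A^T *m invmx Gamma *m A in
  let Cinf : 'M[R]_n := lim (C t @[t --> +oo]) in
  let udag (j : 'I_J) : 'cV[R]_n :=
    u0 j + (E - Cinf *m invmx C0) *m (x - u0 j) in
  let mdag : 'cV[R]_n := m0 + (E - Cinf *m invmx C0) *m (x - m0) in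
  let ulim (j : 'I_J) : 'cV[R]_n := lim (u j t @[t --> +oo]) in
  let mlim : 'cV[R]_n := lim (mean t @[t --> +oo]) in
  let Py : 'cV[R]_m := orth_proj Gamma (range (mulmx A)) y in
  (exists (S : 'M[R]_n) (mu : 'rV[R]_n) (k : nat), diagonalized_by M S mu k) /\
  (forall (S : 'M[R]_n) (mu : 'rV[R]_n) (k : nat), diagonalized_by M S mu k ->
    let Q : R -> 'M[R]_n := sqrtCC0 S mu in
    let Aminus : 'M[R]_n := diag_pinv S mu *m C0 in
    [/\ forall t, 0 <= t ->
          C t *m invmx C0 = diag_conj S (\row_i (1 + 2 * t * mu 0 i)^-1),
        forall t j, 0 <= t ->
          u j t = u0 j + (E - Q t) *m (x - u0 j)
            + Q t *m mx_integral 0 t Q *m (C0 *m A^T *m invmx Gamma *m eps),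
        forall t, 0 <= t ->
          mean t = m0 + (E - Q t) *m (x - m0)
            + Q t *m mx_integral 0 t Q *m (C0 *m A^T *m invmx Gamma *m eps),
        forall j, u j t @[t --> +oo]
          --> udag j + Aminus *m (A^T *m invmx Gamma *m eps) &
        mean t @[t --> +oo] --> mdag + Aminus *m (A^T *m invmx Gamma *m eps)])
  /\ cvg (C t @[t --> +oo])
  /\ (forall j, argmin (fun v => normH C0 (v - u0 j))
                  [set v : 'cV[R]_n | A *m v = ydag] = [set udag j])
  /\ argmin (fun v => normH C0 (v - m0))
       [set v : 'cV[R]_n | A *m v = ydag] = [set mdag]
  /\ (forall j, argmin (fun v => normH C0 (v - u0 j))
                  [set v : 'cV[R]_n | A *m v = Py] = [set ulim j])
  /\ argmin (fun v => normH C0 (v - m0))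
       [set v : 'cV[R]_n | A *m v = Py] = [set mlim]
  /\ (forall j, exists K : R,
         \forall t \near +oo, `|u j t - ulim j| <= K / Num.sqrt t)
  /\ (exists K : R, \forall t \near +oo, `|mean t - mlim| <= K / Num.sqrt t).
Proof.
move=> E mean C m0 C0 M Cinf udag mdag ulim mlim Py.
have Gi_spd := posdef_inv Gamma_spd.
have y_eq : y = A *m x + eps by rewrite xE.
have exS : exists (S : 'M[R]_n) (mu : 'rV[R]_n) (k : nat),
    diagonalized_by M S mu k.
  (* With weight [C_0], [M C_0] is symmetric and [v M C_0 v^T] is the squared [Gamma]-norm of
     [A C_0 v^T]. *)
  apply: (diagonalized_by_exists C0_spd) => [|v].
    by rewrite /M !trmx_mul trmxK Gi_spd.1 C0_spd.1 !mulmxA.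
  have -> : v *m M *m C0 *m v^T
      = (A *m C0 *m v^T)^T *m invmx Gamma *m (A *m C0 *m v^T).
    by rewrite !trmx_mul trmxK C0_spd.1 /M !mulmxA.
  exact: posdef_qform_ge0.
split; first exact: exS.
have C_cvg S mu k : diagonalized_by M S mu k ->
    C t @[t --> +oo] --> null_proj S mu *m C0.
  by move=> MS; apply: msqrt_decay_cvg;
    exact: (sample_cov_decay J_gt0 Gamma_spd u_sol C0_spd MS).
(* The left side does not mention [S], so [null_proj] is the same for every diagonalization. *)
have CinfE S mu k : diagonalized_by M S mu k -> Cinf *m invmx C0
  = null_proj S mu.
  by move=> MS; rewrite /Cinf (cvg_lim _ (C_cvg _ _ _ MS)) ?mulmxK
    ?posdef_unitmx.
have flow_cvg S mu k f : diagonalized_by M S mu k -> EKI_flow A Gamma y u f ->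
    f t @[t --> +oo] --> f 0 + (E - Cinf *m invmx C0) *m (x - f 0)
      + diag_pinv S mu *m C0 *m (A^T *m invmx Gamma *m eps).
  move=> MS ff; rewrite (CinfE _ _ _ MS); apply: msqrt_decay_cvg.
  exact: (EKI_flow_decay J_gt0 Gamma_spd y_eq u_sol C0_spd MS ff).
have flow_lim S mu k f : diagonalized_by M S mu k -> EKI_flow A Gamma y u f ->
    lim (f t @[t --> +oo]) = EKI_limit A Gamma eps u x S mu f.
  move=> MS ff; rewrite (cvg_lim _ (flow_cvg _ _ _ _ MS ff));
    last exact: norm_hausdorff.
  by rewrite (CinfE _ _ _ MS).
have flow_u j : EKI_flow A Gamma y u (u j) := EKI_flow_particle u_sol j.
have flow_m : EKI_flow A Gamma y u mean := EKI_flow_mean J_gt0 u_sol.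
have u_init j : u j 0 = u0 j := u_sol.1 j.
split.
  move=> S mu k MS Q Aminus; split.
  - by move=> t t0; apply: (sample_cov_diag J_gt0 Gamma_spd u_sol C0_spd MS).
  - move=> t j t0; rewrite -u_init.
    exact: (EKI_flow_solution J_gt0 Gamma_spd y_eq u_sol C0_spd MS (flow_u j)
      t0).
  - move=> t t0.
    exact: (EKI_flow_solution J_gt0 Gamma_spd y_eq u_sol C0_spd MS flow_m t0).
  - by move=> j; rewrite /udag -u_init; exact: flow_cvg MS (flow_u j).
  - exact: flow_cvg MS flow_m.
(* The remaining claims do not involve [S], so any one diagonalization serves. *)
have [S [mu [k MS]]] := exS.
split; first by apply/cvg_ex; exists (null_proj S mu *m C0); exact: C_cvg MS.
have argmin_dag f0 : argmin (fun v => normH C0 (v - f0))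
    [set v : 'cV[R]_n | A *m v = ydag]
    = [set f0 + (E - Cinf *m invmx C0) *m (x - f0)].
  by rewrite -xE (CinfE _ _ _ MS); exact: (argmin_fdag Gamma_spd C0_spd MS).
have argmin_lim f : EKI_flow A Gamma y u f ->
    argmin (fun v => normH C0 (v - f 0)) [set v : 'cV[R]_n | A *m v = Py]
    = [set lim (f t @[t --> +oo])].
  move=> ff; rewrite (flow_lim _ _ _ _ MS ff).
  exact: (argmin_flim Gamma_spd C0_spd MS (f 0) y_eq).
have rate f : EKI_flow A Gamma y u f -> exists K : R, \forall t \near +oo,
    `|f t - lim (f t @[t --> +oo])| <= K / Num.sqrt t.
  move=> ff; rewrite (flow_lim _ _ _ _ MS ff); apply: msqrt_decay_rate.
  exact: (EKI_flow_decay J_gt0 Gamma_spd y_eq u_sol C0_spd MS ff).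
split; first by move=> j; exact: argmin_dag.
split; first exact: argmin_dag.
split; first by move=> j; rewrite -u_init; exact: argmin_lim.
split; first exact: argmin_lim.
by split=> [j|]; exact: rate.
Qed.
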